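(* Let $(P,\mathcal S)$ be a polygonal tree system of similarities associated with a convex polygon $P\subset\mathbb R^2$, and let $K$ be its attractor. Then $K$ is a dendrite.
   Context: A polygon is understood as a compact region of the plane with nonempty interior. Let $P\subset\mathbb R^2$ be a convex polygon with vertices $A_1,\dots,A_n$, and let $\mathcal S=\{S_1,\dots,S_m\}$ be a finite system of contracting similarities of $\mathbb R^2$ (maps with $|S_i(x)-S_i(y)|=r_i|x-y|$ for all $x,y$, where $0<r_i<1$). Put $P_k=S_k(P)$. The system $(P,\mathcal S)$ is called a polygonal tree system associated with $P$ if: (D1) $P_k\subset P$ for all $k$; (D2) for $i\ne j$, $P_i\cap P_j$ is either empty or consists of exactly one point which is a common vertex of $P_i$ and $P_j$; (D3) for every vertex $A_k$ of $P$ there is an $i$ with $A_k\in P_i$; (D4) the set $\widetilde P=\bigcup_{i=1}^m P_i$ is contractible. The attractor of $\mathcal S$ is the unique nonempty compact set $K\subset\mathbb R^2$ with $K=\bigcup_{i=1}^m S_i(K)$. A dendrite is a locally connected continuum (compact connected metric space) containing no simple closed curve. *)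

(* Defs.v *)
From HB Require Import structures.
From mathcomp Require Import all_boot all_order all_algebra.
From mathcomp Require Import all_classical all_reals all_analysis.

Set Implicit Arguments.
Unset Strict Implicit.
Unset Printing Implicit Defensive.

Import Order.TTheory GRing.Theory Num.Theory.
Import numFieldTopology.Exports numFieldNormedType.Exports.

Local Open Scope classical_set_scope.
Local Open Scope ring_scope.

Section GeneralTopology.
Variables (R : realType) (T : topologicalType).
Implicit Types A C K : set T.

Definition contractible A : Prop :=
  exists2 x0 : T, A x0 &
  exists H : R * T -> T,
    [/\ {within `[0, 1]%classic `*` A, continuous H},
        forall (t : R) x, 0 <= t <= 1 -> A x -> A (H (t, x)),
        forall x, A x -> H (0, x) = x &
        forall x, A x -> H (1, x) = x0].

(* [C] is the image of a closed path that is injective on [0, 1[; in a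
   Hausdorff space this means that [C] is homeomorphic to a circle. *)
Definition simple_closed_curve C : Prop :=
  exists g : R -> T,
    [/\ {within `[0, 1], continuous g}, g 0 = g 1,
        {in `[0, 1[ &, injective g} & g @` `[0, 1] = C].

(* Local connectedness for the topology induced on [K]: every point of [K]
   has arbitrarily small connected neighbourhoods that are open in [K]. *)
Definition locally_connected K : Prop :=
  forall x, K x -> forall U : set T, nbhs x U ->
  exists V : set T, [/\ open V, V x, connected (K `&` V) & K `&` V `<=` U].

End GeneralTopology.

Arguments contractible R {T} A.
Arguments simple_closed_curve R {T} C.

(* The library norm on ['rV[R]_2] is the sup norm; it induces the usual
   topology, but similarities are measured with the Euclidean distance
   [eucl_dist] below. *)
Notation plane R := 'rV[R]_2 (only parsing).

Section Plane.
Variable R : realType.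
Implicit Types (P K C : set (plane R)).

Definition eucl_dist (x y : plane R) : R :=
  Num.sqrt (\sum_(i < 2) (x 0 i - y 0 i) ^+ 2).

Definition continuum K : Prop := [/\ K !=set0, compact K & connected K].

Definition dendrite K : Prop :=
  [/\ continuum K, locally_connected K &
      ~ exists2 C, simple_closed_curve R C & C `<=` K].

Definition convex_hull (X : set (plane R)) : set (plane R) :=
  smallest (@convex_set R (plane R)) X.

(* The last condition makes the listed points exactly the vertices of [P],
   without repetition: none of them lies in the hull of the others. *)
Definition convex_polygon n P (A : 'I_n -> plane R) : Prop :=
  [/\ P = convex_hull (range A), P° !=set0 &
      forall i : 'I_n, ~ convex_hull (A @` [set j | j != i]) (A i)].

Definition contracting_similarity (f : plane R -> plane R) : Prop :=
  exists r : R, 0 < r < 1 /\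
    forall x y, eucl_dist (f x) (f y) = r * eucl_dist x y.

(* The vertices of the polygon [S i @` P] are the points [S i (A k)]. *)
Definition polygonal_tree_system n m P (A : 'I_n -> plane R)
    (S : 'I_m -> plane R -> plane R) : Prop :=
  [/\ forall i, S i @` P `<=` P,
      forall i j : 'I_m, i != j ->
        (S i @` P) `&` (S j @` P) = set0 \/
        exists x, [/\ (S i @` P) `&` (S j @` P) = [set x],
                      range (S i \o A) x & range (S j \o A) x],
      forall k, exists i, (S i @` P) (A k) &
      contractible R (\bigcup_i (S i @` P))].

Definition attractor m (S : 'I_m -> plane R -> plane R) K : Prop :=
  [/\ K !=set0, compact K & K = \bigcup_i (S i @` K)].

End Plane.

(* Main.v *)
Require Import Defs.
From mathcomp Require Import all_boot all_order all_algebra.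
From mathcomp Require Import all_classical all_reals all_analysis.
From mathcomp Require Import ring lra.

(** Let P_i = S_i(P) be the pieces of the system.

    The contractibility of their union says that the pieces are arranged like
    a tree, in the following form ([tree_cut]): for a vertex v of P_i, the
    pieces hanging on P_i at v, together with everything attached behind them,
    meet the remaining pieces (P_i among them) in v only. To see this, take the
    map from the union of the pieces to the circle R/Z that is given on P_i by
    a bump of height 1 around v, small enough to vanish at the other common
    vertices, and is constantly 0 elsewhere. It is continuous, because the bump
    takes integer values where P_i meets other pieces. A map from a compact
    contractible space to the circle lifts to a continuous real function h
    ([homotopy_circle_lift]). On P_i the lift is the bump plus a constant, on
    each other piece it is constant; the pieces on which h takes its value at v
    are the ones hanging at v.

    Iterating the S_i shows that K lies in P ([attractor_sub_polygon]). A
    vertex of P that belongs to P_i is an extreme point of P, hence it is the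
    image under S_i of a vertex ([vertex_of_affine_copy]); iterating this shows
    that the vertices of P lie in K ([vertex_in_attractor]). So pieces
    that meet give copies S_i(K) that meet, and K meets P_i in S_i(K) only.

    K is connected: if a set of points of K is unaffected by jumps of length
    less than d inside K, its preimages under the S_i are unaffected by jumps
    of length less than d/r, where r < 1 bounds all ratios. Once d exceeds the
    diameter of K the set is trivial, and then it is trivial at all scales,
    since the intersection graph of the pieces is connected. Hence K is,
    for every e, a finite union of compact connected sets of diameter less than
    e, which gives local connectedness.

    Finally let J be a simple closed curve in K. Removing one point from J
    leaves a connected set, so J never passes through a cut point from one side
    to the other, and J lies in a single piece ([circle_in_one_piece]), hence
    in some S_i(K). Its preimage under S_i is a simple closed curve in K as
    well ([closed_curve_descends]). Repeating this, J is contained in copies of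
    K of arbitrarily small diameter, which is absurd. *)

Set Implicit Arguments.
Unset Strict Implicit.
Unset Printing Implicit Defensive.
Import Order.TTheory GRing.Theory Num.Theory.
Import numFieldTopology.Exports numFieldNormedType.Exports.
Local Open Scope classical_set_scope.
Local Open Scope ring_scope.

(** * Connectedness and locally constant predicates *)

(** The set of points of [A] where a locally constant predicate holds is clopen
    in [A]. In this form connectedness applies directly to predicates that are
    propagated by nearness, and conversely can be proved by such a propagation. *)
Lemma connected_locally_constantP (T : topologicalType) (A : set T) :
  connected A <->
  forall Q : T -> Prop,
    (forall x, A x -> \forall y \near x, A y -> (Q y <-> Q x)) ->
    forall x y, A x -> A y -> Q x -> Q y.
Proof.
split=> [cA Q Qloc x y Ax Ay Qx | cst B [x Bx] [V oV BV] [F cF BF]].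
- suff AQ : A `&` Q = A by move: Ay; rewrite -AQ => -[].
  apply: cA; first by exists x.
  + exists [set z | A z -> Q z]°; first exact: open_interior.
    apply/seteqP; split=> z [Az]; last by move=> /nbhs_singleton/(_ Az).
    move=> Qz; split=> //.
    by apply: filterS (Qloc z Az) => w Qw Aw; apply/Qw.
  + exists (~` [set z | A z -> ~ Q z]°).
      by apply: open_closedC; exact: open_interior.
    apply/seteqP; split=> z [Az].
      by move=> Qz; split=> // /nbhs_singleton/(_ Az).
    move=> nQ; split=> //; apply: contrapT => nQz; apply: nQ.
    by apply: filterS (Qloc z Az) => w Qw Aw /(Qw Aw).
- have AB : B `<=` A by rewrite BV => z [].
  apply/seteqP; split=> // y Ay; apply: (cst B _ x y) => //; last exact: AB.
  move=> z Az; have [Bz|nBz] := pselect (B z).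
  + have Vz : V z by move: Bz; rewrite BV => -[].
    apply: filterS (open_nbhs_nbhs (conj oV Vz)) => w Vw Aw.
    by split=> // _; rewrite BV.
  + have Fz : (~` F) z by move=> Fz; apply: nBz; rewrite BF.
    have oF : open (~` F) by exact: closed_openC.
    apply: filterS (open_nbhs_nbhs (conj oF Fz)) => w nFw Aw.
    by split=> //; rewrite {1}BF => -[].
Qed.

Lemma within_continuous_distP (R : realType) (T : topologicalType) (A : set T)
    (f : T -> R) :
  {within A, continuous f} <->
  forall x, A x -> forall e, 0 < e -> \forall y \near x, A y -> `|f y - f x| < e.
Proof.
split.
  move=> /subspace_continuousP fc x Ax e e0.
  have /cvgrPdist_lt/(_ _ e0) := fc x Ax; rewrite near_withinE.
  by apply: filterS => y + Ay => /(_ Ay); rewrite distrC.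
move=> fc; apply/subspace_continuousP => x Ax.
apply/cvgrPdist_lt => e e0; rewrite near_withinE.
by apply: filterS (fc x Ax e e0) => y + Ay => /(_ Ay); rewrite distrC.
Qed.

Lemma int_lt1_eq0 (R : realType) (k : int) : `|k%:~R : R| < 1 -> k = 0.
Proof.
move=> k1; apply/eqP; rewrite -absz_eq0; move: k1.
by rewrite -intr_norm (_ : 1 = 1%:~R) // ltr_int; case: k => [[|k]|k].
Qed.

Lemma connected_integer_constant (R : realType) (T : topologicalType)
    (A : set T) (f : T -> R) :
  connected A -> {within A, continuous f} ->
  (forall x, A x -> exists k : int, f x = k%:~R) ->
  forall x y, A x -> A y -> f x = f y.
Proof.
move=> /connected_locally_constantP cA /within_continuous_distP fc fZ x y Ax Ay.
apply: (cA (fun z => f x = f z) _ x y) => // z Az.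
apply: filterS (fc z Az 1 ltr01) => w fw Aw; move: (fw Aw).
have [k ->] := fZ z Az; have [l ->] := fZ w Aw.
by rewrite -intrB => /int_lt1_eq0/subr0_eq ->.
Qed.

(** * Lifting circle-valued maps *)

(** Continuity of [f] regarded as a map to the circle R/Z. Working modulo 1 with
    real representatives avoids a model of the circle and trigonometry. *)
Definition circle_continuous (R : realType) (T : topologicalType) (A : set T)
    (f : T -> R) :=
  forall x, A x -> forall e, 0 < e ->
  \forall y \near x, A y -> exists k : int, `|f y - f x - k%:~R| < e.

Lemma circle_continuous_comp (R : realType) (T U : topologicalType)
    (D : set U) (A : set T) (H : U -> T) (f : T -> R) :
  {within D, continuous H} -> (forall z, D z -> A (H z)) ->
  circle_continuous A f -> circle_continuous D (f \o H).
Proof.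
move=> /subspace_continuousP Hc HA fc z Dz e e0.
have : nbhs z (fun y => D y -> A (H y) ->
    exists k : int, `|f (H y) - f (H z) - k%:~R| < e).
  exact: Hc z Dz _ (fc _ (HA z Dz) e e0).
by apply: filterS => w + Dw => /(_ Dw (HA w Dw)).
Qed.

Definition circle_lift (R : realType) (T : topologicalType) (A : set T)
    (f h : T -> R) :=
  {within A, continuous h} /\ forall x, A x -> exists k : int, h x = f x + k%:~R.

(** The difference of two maps to R/Z that are uniformly close has a unique
    representative in ]-1/4, 1/4[, and this representative is continuous; it
    corrects a lift of [f] into a lift of [g]. *)
Lemma circle_lift_perturb (R : realType) (T : topologicalType) (A : set T)
    (f g : T -> R) :
  circle_continuous A g ->
  (forall x, A x -> exists k : int, `|g x - f x - k%:~R| < 4^-1) ->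
  (exists h, circle_lift A f h) -> exists h, circle_lift A g h.
Proof.
move=> gc fg [h [/within_continuous_distP hc hf]].
have {fg} [d dP] : {d : T -> int &
    forall x, A x -> `|g x - f x - (d x)%:~R| < 4^-1}.
  apply: (@choice _ _ (fun x d => A x -> `|g x - f x - d%:~R| < 4^-1)) => x.
  have [/fg[k Hk]|nA] := pselect (A x); first by exists k.
  by exists 0.
pose h' x := h x + (g x - f x - (d x)%:~R).
have h'g x : A x -> exists k : int, h' x = g x + k%:~R.
  move=> Ax; have [k hk] := hf x Ax; exists (k - d x).
  by rewrite /h' hk intrB; lra.
exists h'; split=> //; apply/within_continuous_distP => x Ax e e0.
have m0 : 0 < Num.min e 4^-1 by rewrite lt_min e0; lra.
have q0 : 0 < 4^-1 :> R by lra.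
have [k hk] := h'g x Ax.
near=> y => Ay; have [l hl] := h'g y Ay.
have [j] : exists k : int, `|g y - g x - k%:~R| < Num.min e 4^-1.
  by move: Ay; near: y; exact: gc.
rewrite lt_min => /andP[je j4].
have hxy : `|h y - h x| < 4^-1 by move: Ay; near: y; exact: hc.
have dx := dP x Ax; have dy := dP y Ay.
(* both the real and the mod-1 variation are small, so the integer vanishes *)
have /int_lt1_eq0 lkj : `|(l - k + j)%:~R : R| < 1.
  move: hl hk; rewrite /h' !(intrB, intrD) => hl hk.
  move: hxy dx dy j4; rewrite !ltr_norml => /andP[? ?] /andP[? ?] /andP[? ?] /andP[? ?].
  by apply/andP; split; lra.
have lkjR : l%:~R - k%:~R + j%:~R = 0 :> R by rewrite -intrB -intrD lkj.
suff -> : h' y - h' x = g y - g x - j%:~R by [].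
by rewrite hl hk; lra.
Unshelve. all: by end_near. Qed.

(** By compactness of [A], nearby stages of the homotopy are uniformly close, so
    the set of times at which a lift exists is clopen in [0, 1]. It contains 1,
    where the stage is constant. *)
Lemma homotopy_circle_lift (R : realType) (T : topologicalType) (A : set T)
    (f : R * T -> R) (c : R) :
  compact A -> @circle_continuous R (R * T)%type (`[0, 1]%classic `*` A) f ->
  (forall x, A x -> f (1, x) = c) ->
  exists h, circle_lift A (fun x => f (0, x)) h.
Proof.
move=> /compact_near_coveringP/near_covering_withinP cA fc f1.
have slice t : 0 <= t <= 1 -> circle_continuous A (fun x => f (t, x)).
  move=> t01 x Ax e e0.
  have [[U V] /= [Ut Vx] UV] := fc (t, x) (conj t01 Ax) e e0.
  apply: filterS Vx => y Vy Ay; apply: (UV (t, y)) => //; split=> //=.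
  exact: nbhs_singleton.
have close t s : 0 <= t <= 1 -> 0 <= s <= 1 ->
    (forall x, A x -> exists k : int, `|f (t, x) - f (s, x) - k%:~R| < 4^-1) ->
    (exists h, circle_lift A (fun x => f (s, x)) h) ->
    exists h, circle_lift A (fun x => f (t, x)) h.
  by move=> t01 s01; apply: circle_lift_perturb; exact: slice.
have /connected_locally_constantP c01 : connected (`[0, 1]%classic : set R).
  exact: segment_connected.
have m0 : (`[0, 1]%classic : set R) 0 by rewrite /= in_itv /= lexx ler01.
have m1 : (`[0, 1]%classic : set R) 1 by rewrite /= in_itv /= lexx ler01.
apply: (c01 (fun t => exists h, circle_lift A (fun x => f (t, x)) h) _ 1 0) => //.
  move=> s s01.
  have near_s : \forall t \near s, A `<=` [set x | 0 <= t <= 1 ->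
      exists k : int, `|f (t, x) - f (s, x) - k%:~R| < 4^-1].
    apply: (cA _ (nbhs s) (fun t x => 0 <= t <= 1 ->
      exists k : int, `|f (t, x) - f (s, x) - k%:~R| < 4^-1)) => x Ax.
    have e0 : 0 < 8^-1 :> R by lra.
    have fsx := slice s s01 x Ax _ e0.
    have ftx : \forall y \near x & t \near s, A y -> 0 <= t <= 1 ->
        exists k : int, `|f (t, y) - f (s, x) - k%:~R| < 8^-1.
      have [[U V] /= [Us Vx] UV] := fc (s, x) (conj s01 Ax) _ e0.
      by exists (V, U) => //= -[y t] [/= Vy Ut] Ay t01; apply: (UV (t, y)).
    case: ftx => -[V U] /= [Vx Us] VU.
    exists (V `&` [set y | A y -> exists k : int,
      `|f (s, y) - f (s, x) - k%:~R| < 8^-1], U); first by split=> //; exact: filterI.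
    move=> [y t] [/= [Vy fsy] Ut] Ay t01.
    have [k hk] := VU (y, t) (conj Vy Ut) Ay t01.
    have [l hl] := fsy Ay.
    exists (k - l); move: hk hl; rewrite intrB !ltr_norml.
    by move=> /andP[? ?] /andP[? ?]; apply/andP; split; lra.
  near=> t => t01.
  have ts : forall x, A x ->
      exists k : int, `|f (t, x) - f (s, x) - k%:~R| < 4^-1.
    by move=> x Ax; apply: (near near_s t).
  split; apply: close => // x /ts[k hk]; exists (- k).
  suff -> : f (s, x) - f (t, x) - (- k)%:~R = - (f (t, x) - f (s, x) - k%:~R).
    by rewrite normrN.
  by rewrite mulrNz; lra.
exists (fun=> c); split; first by apply: continuous_subspaceT => ?; exact: cvg_cst.
by move=> x Ax; exists 0; rewrite f1 // addr0.
Unshelve. all: by end_near. Qed.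

(** * Unions of closed sets, curves and small covers *)

Lemma finite_bigcup_compact (T : topologicalType) (I : finType)
    (F : I -> set T) : (forall i, compact (F i)) -> compact (\bigcup_i F i).
Proof.
move=> cF; apply/compact_near_coveringP => J G Q FG FQ.
have /filter_forall FQi i : \forall j \near G, F i `<=` Q j.
  move/compact_near_coveringP : (cF i); apply => // x Fx.
  by apply: FQ; exists i.
by apply: filterS FQi => j FQj x [i _]; exact: FQj.
Qed.

Lemma finite_bigcup_closed (T : topologicalType) (I : finType) (D : set I)
    (F : I -> set T) :
  (forall i, closed (F i)) -> closed (\bigcup_(i in D) F i).
Proof. by move=> cF; apply: closed_bigcup => //; exact: finite_finset. Qed.

(** The trace of [X] on [C] is relatively open, being the complement of that of
    [Y]. *)
Lemma connected_sub_closed (T : topologicalType) (C X Y : set T) (p : T) :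
  connected C -> closed X -> closed Y -> C `<=` X `|` Y ->
  (forall x, C x -> X x -> Y x -> False) -> C p -> X p -> C `<=` X.
Proof.
move=> cC clX clY CXY XY Cp Xp.
suff <- : C `&` X = C by move=> x [].
apply: cC; first by exists p.
- exists (~` Y); first exact: closed_openC.
  apply/seteqP; split=> x [Cx]; first by move=> Xx; split=> // /(XY x Cx Xx).
  by move=> nYx; split=> //; case: (CXY x Cx).
- by exists X.
Qed.

Lemma contractible_connected (R : realType) (T : topologicalType) (A : set T) :
  contractible R A -> connected A.
Proof.
move=> [x0 Ax0 [H [Hc HA H0 H1]]].
pose track x := (fun t => H (t, x)) @` (`[0, 1]%classic : set R).
have m0 : (`[0, 1]%classic : set R) 0 by rewrite /= in_itv /= lexx ler01.
have m1 : (`[0, 1]%classic : set R) 1 by rewrite /= in_itv /= lexx ler01.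
have -> : A = \bigcup_(x in A) track x.
  apply/seteqP; split=> [x Ax|_ [x Ax] [t t01 <-]].
    by exists x => //; exists 0 => //; exact: H0.
  by apply: HA => //; move: t01; rewrite /= in_itv.
apply: bigcup_connected; first by exists x0 => x Ax; exists 1 => //; exact: H1.
move=> x Ax; apply: connected_continuous_connected; first exact: segment_connected.
apply/subspace_continuousP => t t01 B /=.
move/subspace_continuousP : Hc => /(_ (t, x) (conj t01 Ax) B) Hc.
move=> /Hc; rewrite /nbhs /= => -[[U W] [/= Ut Wx] UW].
have : nbhs t (fun s => (`[0, 1]%classic : set R) s -> B (H (s, x))); last by [].
apply: filterS Ut => s Us s01.
by apply: (UW (s, x)) => //; split=> //=; exact: nbhs_singleton.
Qed.

(** Away from [v], the curve is an open arc if [v] is the base point, and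
    otherwise the union of two arcs that both contain the base point. *)
Lemma punctured_closed_curve_connected (R : realType) (T : topologicalType)
    (g : R -> T) (v : T) :
  {within `[0, 1], continuous g} -> g 0 = g 1 -> {in `[0, 1[ &, injective g} ->
  connected (g @` `[0, 1] `\ v).
Proof.
move=> gc g01 ginj.
have img (i : interval R) : [set` i] `<=` `[0, 1] -> connected (g @` [set` i]).
  move=> i01; apply: connected_continuous_connected.
    by apply/connected_intervalP; exact: interval_is_interval.
  exact: continuous_subspaceW gc.
have [[s s01 gs]|nv] := pselect (exists2 s, s \in `[0, 1[ & g s = v); last first.
  rewrite (_ : _ `\ v = g @` `[0, 1]); first exact: img.
  apply/seteqP; split=> [x []//|_ [t t01 <-]]; split; first by exists t.
  move=> gtv; apply: nv; move: t01; rewrite /= in_itv /= => /andP[t0].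
  rewrite le_eqVlt => /predU1P[t1|t1]; last by exists t => //; rewrite in_itv /= t0.
  by exists 0; [rewrite in_itv /= lexx ltr01|rewrite g01 -t1].
move: (s01); rewrite in_itv /= => /andP[s0 s1].
have inj t : 0 <= t -> t < 1 -> t <> s -> g t <> v.
  by move=> t0 t1 ts; rewrite -gs => /ginj ts'; apply: ts; apply: ts'; rewrite in_itv /= ?t0.
move: s0; rewrite le_eqVlt => /predU1P[s0|s0].
  have -> : g @` `[0, 1] `\ v = g @` `]0, 1[.
    apply/seteqP; split=> [_ [[t + <-] gtv]|_ [t + <-]];
      rewrite /= in_itv /= => /andP[t0 t1]; last first.
      split; first by exists t => //; rewrite /= in_itv /= !ltW.
      by apply: inj => //; [exact: ltW|move=> ts; move: t0; rewrite ts -s0 ltxx].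
    exists t => //; rewrite /= in_itv /= !lt_neqAle t0 t1 !andbT; apply/andP.
    split; apply/eqP => tE; apply: gtv; first by rewrite -tE s0.
    by rewrite tE -g01 s0.
  by apply: img => t; rewrite /= !in_itv /= => /andP[? ?]; rewrite !ltW.
have -> : g @` `[0, 1] `\ v = g @` `[0, s[ `|` g @` `]s, 1].
  apply/seteqP; split=> [_ [[t + <-] gtv]|_ [] [t + <-]];
    rewrite /= in_itv /= => /andP[t0 t1].
  - have [ts|ts|ts] := ltgtP t s; last by case: gtv; rewrite ts.
    + by left; exists t => //; rewrite /= in_itv /= t0.
    + by right; exists t => //; rewrite /= in_itv /= ts.
  - have t1' : t < 1 by exact: lt_trans s1.
    split; first by exists t => //; rewrite /= in_itv /= t0 ltW.
    by apply: inj => // ts; move: t1; rewrite ts ltxx.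
  - split; first by exists t => //; rewrite /= in_itv /= t1 andbT (ltW (lt_trans s0 t0)).
    move: t1; rewrite le_eqVlt => /predU1P[->|t1].
      by rewrite -g01; apply: inj => // s0'; move: s0; rewrite -s0' ltxx.
    apply: inj => //; first exact: ltW (lt_trans s0 t0).
    by move=> ts; move: t0; rewrite ts ltxx.
apply: connectedU.
- exists (g 0); split; first by exists 0 => //; rewrite /= in_itv /= lexx.
  by exists 1 => //; rewrite /= in_itv /= s1 lexx.
- by apply: img => t; rewrite /= !in_itv /= => /andP[-> ts]; rewrite ltW // (lt_trans ts).
- by apply: img => t; rewrite /= !in_itv /= => /andP[st ->]; rewrite ltW // (lt_trans s0).
Qed.

(** Pigeonhole: [#|J|.+1] equidistant parameters cannot all be sent to the
    [#|J|] points [w j]. *)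
Lemma injective_curve_avoids_finite (R : realType) (T : Type) (g : R -> T) (J : finType)
    (w : J -> T) : {in `[0, 1[ &, injective g} ->
  exists2 t, t \in `[0, 1[ & forall j, g t <> w j.
Proof.
move=> ginj; apply: contrapT => no.
have t01 (k : 'I_(#|J|.+1)) : (k%:R / #|J|.+1%:R : R) \in `[0, 1[.
  rewrite in_itv /= divr_ge0 //= ltr_pdivrMr ?ltr0n // mul1r ltr_nat.
  exact: ltn_ord.
have [f fP] : {f : 'I_(#|J|.+1) -> J &
    forall k : 'I_(#|J|.+1), g (k%:R / #|J|.+1%:R) = w (f k)}.
  apply: (@choice _ _ (fun (k : 'I_(#|J|.+1)) j => g (k%:R / #|J|.+1%:R) = w j)) => k.
  apply: contrapT => nj; apply: no; exists (k%:R / #|J|.+1%:R) => // j gj.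
  by apply: nj; exists j.
have nz : (#|J|.+1%:R : R)^-1 != 0 by rewrite invr_eq0 pnatr_eq0.
have finj : injective f.
  move=> k l fkl; have := fP l; rewrite -fkl -fP => /(ginj _ _ (t01 _) (t01 _)).
  by move=> /(mulIf nz)/eqP; rewrite eqr_nat => /eqP/val_inj.
by have := leq_card f finj; rewrite card_ord ltnn.
Qed.

Lemma lebesgue_number (R : realType) (V : normedModType R) (K : set V)
    (Q : V -> Prop) : compact K ->
  (forall x, K x -> \forall y \near x, K y -> (Q y <-> Q x)) ->
  exists2 d : R, 0 < d &
    forall x y, K x -> K y -> `|x - y| < d -> Q x -> Q y.
Proof.
move=> /compact_near_coveringP/near_covering_withinP cK Qloc.
have : \forall d \near (0:R)^'+, K `<=` (fun d x =>
    forall y, K y -> `|x - y| < d -> Q x -> Q y) d.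
  apply: cK => x Kx; have /nbhs_normP[e /= e0 He] := Qloc x Kx.
  have e20 : 0 < e / 2 by lra.
  exists (ball x (e / 2), [set d | d < e / 2]).
    by split=> /=; [exact: nbhsx_ballx|exact: nbhs_right_lt].
  move=> [z d] [/=]; rewrite -ball_normE /= => xz de Kz y Ky zy Qz.
  have /(He z)/(_ Kz) [Qx _] : ball_ Num.norm x e z by rewrite /ball_ /=; lra.
  have /(He y)/(_ Ky) [_] : ball_ Num.norm x e y.
    rewrite /ball_ /= (_ : x - y = (x - z) + (z - y)); last first.
      by rewrite addrA subrK.
    by rewrite (le_lt_trans (ler_normD _ _)) //; lra.
  by apply; exact: Qx.
move=> near_d; have [d [d0 Kd]] := filter_ex (filterI (nbhs_right_gt (0:R)) near_d).
by exists d => // x y Kx; exact: Kd.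
Qed.

(** Around a point of [K], the members of a fine cover that contain the point
    form a small neighbourhood in [K], because the other members are finitely
    many closed sets. As members are connected, every component of a relatively
    open set is relatively open. *)
Lemma small_connected_covers_locally_connected (R : realType)
    (V : normedModType R) (K : set V) :
  (forall e : R, 0 < e -> exists (I : finType) (C : I -> set V),
    [/\ K = \bigcup_i C i,
        forall i, closed (C i), forall i, connected (C i) &
        forall i x y, C i x -> C i y -> `|x - y| < e]) ->
  locally_connected K.
Proof.
move=> cover x Kx U Ux.
pose D := connected_component (K `&` U°) x.
have KUx : (K `&` U°) x by split.
pose W := \bigcup_(W in [set W : set V | open W /\ K `&` W `<=` D]) W.
have KW : K `&` W = D.
  apply/seteqP; split=> [y [Ky [W' [oW' KW'D] W'y]]|y Dy]; first exact: KW'D.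
  have [Ky Uy] : (K `&` U°) y by exact: connected_component_sub Dy.
  split=> //.
  have /nbhs_normP[e /= e0 He] : nbhs y U°.
    exact: (open_nbhs_nbhs (conj (@open_interior _ U) Uy)).
  have [I [C [KC clC cC Ce]]] := cover e e0.
  exists (~` \bigcup_(i in [set i | ~ C i y]) C i); last by move=> [i /= nCi /nCi].
  split; first by apply: closed_openC; exact: finite_bigcup_closed.
  move=> z [Kz nz]; have [i _ Ciz] : (\bigcup_i C i) z by rewrite -KC.
  have Ciy : C i y by apply: contrapT => nCy; apply: nz; exists i.
  rewrite /D (same_connected_component Dy).
  apply: (connected_component_max Ciy) Ciz => // w Ciw; split.
    by rewrite KC; exists i.
  by apply: He; rewrite /ball_ /=; exact: (Ce i).
exists W; split.
- by apply: bigcup_open => W' [].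
- by have : (K `&` W) x by [rewrite KW; exact: connected_component_refl]; case.
- by rewrite KW; exact: component_connected.
- rewrite KW => y /connected_component_sub[_]; exact: interior_subset.
Qed.

(** * Trees of compact sets *)

Definition tent (R : realType) (V : normedModType R) (v : V) (d : R) (x : V) : R :=
  Num.max 0 (1 - `|x - v| / d).

Lemma tent_center (R : realType) (V : normedModType R) (v : V) (d : R) :
  tent v d v = 1.
Proof. by rewrite /tent subrr normr0 mul0r subr0; apply/max_idPr. Qed.

Lemma tent_eq1 (R : realType) (V : normedModType R) (v x : V) (d : R) :
  0 < d -> tent v d x = 1 -> x = v.
Proof.
move=> d0; rewrite /tent; case: leP => [_ h|_ /eqP]; last by rewrite eq_sym oner_eq0.
have /eqP : `|x - v| / d = 0 by lra.
by rewrite mulf_eq0 invr_eq0 (gt_eqF d0) orbF normr_eq0 subr_eq0 => /eqP.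
Qed.

Lemma tent_far (R : realType) (V : normedModType R) (v x : V) (d : R) :
  0 < d -> d <= `|x - v| -> tent v d x = 0.
Proof.
by move=> d0 dx; apply/max_idPl; rewrite subr_le0 ler_pdivlMr // mul1r.
Qed.

Lemma tent_lipschitz (R : realType) (V : normedModType R) (v x y : V) (d : R) :
  0 < d -> `|tent v d x - tent v d y| <= `|x - y| / d.
Proof.
move=> d0.
have : `| `|x - v| / d - `|y - v| / d | <= `|x - y| / d.
  rewrite -mulrBl normrM [`|d^-1|]gtr0_norm ?invr_gt0 //.
  rewrite ler_pM2r ?invr_gt0 // (le_trans (ler_dist_dist _ _)) //.
  by rewrite opprB addrA subrK.
rewrite /tent; move: (_ / d) (_ / d) (_ / d) => a b c.
rewrite !ler_norml => /andP[h1 h2].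
by have [?|?] := leP 0 (1 - c); have [?|?] := leP 0 (1 - b); apply/andP; split; lra.
Qed.

Lemma tent_continuous (R : realType) (V : normedModType R) (v : V) (d : R) :
  0 < d -> continuous (tent v d).
Proof.
move=> d0 x; apply/cvgrPdist_lt => e e0; near=> y.
rewrite (le_lt_trans (tent_lipschitz _ _ _ d0)) // ltr_pdivrMr //.
by near: y; apply: cvgr_dist_lt => //; exact: mulr_gt0.
Unshelve. all: by end_near. Qed.

(** Pieces need not be polygons here: only compact connected sets that meet
    pairwise in at most one point and have a contractible union. *)
Section TreeOfPieces.
Variables (R : realType) (V : normedModType R) (I : finType) (F : I -> set V).
Hypothesis F_compact : forall i, compact (F i).
Hypothesis F_connected : forall i, connected (F i).
Hypothesis F_meet : forall i j x y, i != j ->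
  F i x -> F j x -> F i y -> F j y -> x = y.
Hypothesis F_contractible : contractible R (\bigcup_i F i).

Let F_closed i : closed (F i).
Proof. by apply: compact_closed => //; exact: norm_hausdorff. Qed.

(** [F i] meets the finitely many other pieces in finitely many points. *)
Lemma isolating_radius i v : exists2 d : R, 0 < d &
  forall j x, j != i -> F i x -> F j x -> x <> v -> d <= `|x - v|.
Proof.
have /filter_forall nd j : \forall d \near (0:R)^'+,
    forall x, j != i -> F i x -> F j x -> x <> v -> d <= `|x - v|.
  have [[y [ji Fiy Fjy yv]]|no] :=
      pselect (exists y, [/\ j != i, F i y, F j y & y <> v]); last first.
    by near=> d => x ji Fix Fjx xv; case: no; exists x.
  have yv0 : 0 < `|y - v| by rewrite normr_gt0 subr_eq0; apply/eqP.
  apply: filterS (nbhs_right_lt yv0) => d /ltW dy x _ Fix Fjx _.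
  by rewrite (F_meet ji Fjx Fix Fjy Fiy).
have [d [d0 Hd]] := filter_ex (filterI (nbhs_right_gt (0:R)) nd).
by exists d => // j x; exact: Hd.
Unshelve. all: by end_near. Qed.

(** [Y] indexes the branches hanging on [F i] at [v]. They are read off from the
    lift [h] of the bump at [v] on [F i], viewed in R/Z: the lift of the bump goes
    up by 1 at [v] and stays there on all pieces reached through [v], so these
    cannot return to [F i] at a point where the bump vanishes. *)
Lemma tree_cut i v : F i v -> exists Y : set I,
  [/\ ~ Y i, forall j, j != i -> F j v -> Y j &
      forall a b x, Y a -> ~ Y b -> F a x -> F b x -> x = v].
Proof.
move=> Fiv; have [d d0 dfar] := isolating_radius i v.
pose g := tent v d.
pose th x : R := if pselect (F i x) then g x else 0.
have thi x : F i x -> th x = g x by rewrite /th; case: pselect.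
have thj j x : j != i -> F j x -> exists k : int, th x = k%:~R.
  move=> ji Fjx; have [Fix|nFix] := pselect (F i x); last first.
    by exists 0; rewrite /th; case: pselect.
  rewrite thi //.
  have [->|xv] := pselect (x = v); first by exists 1; exact: tent_center.
  by exists 0; rewrite /g tent_far //; exact: dfar Fjx xv.
have thc : circle_continuous (\bigcup_i F i) th.
  move=> x _ e e0.
  have /filter_forall near_th j : \forall y \near x, F j y ->
      exists k : int, `|th y - th x - k%:~R| < e.
    have [Fjx|nFjx] := pselect (F j x); last first.
      have oF : open (~` F j) by exact: closed_openC.
      by apply: filterS (open_nbhs_nbhs (conj oF nFjx)) => y nFjy /nFjy.
    have [ji|ji] := eqVneq j i.
      subst j; have /cvgrPdist_lt/(_ e e0) := @tent_continuous R V v d d0 x.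
      apply: filterS => y gxy Fiy; exists 0.
      by rewrite subr0 !thi // distrC.
    near=> y => Fjy; have [k ->] := thj j x ji Fjx; have [l ->] := thj j y ji Fjy.
    by exists (l - k); rewrite intrB subrr normr0.
  by apply: filterS near_th => y near_y [j _]; exact: near_y.
have [x0 Fx0 [H [Hc HF H0 H1]]] := F_contractible.
have [h [hc hth]] : exists h, circle_lift (\bigcup_i F i) th h.
  have [] := @homotopy_circle_lift R V (\bigcup_i F i) (th \o H) (th x0).
  - exact: finite_bigcup_compact.
  - apply: circle_continuous_comp Hc _ thc => -[t x] [/= t01 Fx].
    by apply: HF => //; move: t01; rewrite in_itv.
  - by move=> x Fx /=; rewrite H1.
  move=> h [hc hth]; exists h; split=> // x Fx.
  by have [k] := hth x Fx; rewrite /= H0 //; exists k.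
have sub j x : F j x -> (\bigcup_i F i) x by exists j.
have hi x : F i x -> h x = h v - 1 + g x.
  move=> Fix; have : h x - g x = h v - g v.
    apply: (@connected_integer_constant R V (F i) (fun y => h y - g y)) => //.
      have /subspace_continuousP hci : {within F i, continuous h}.
        by apply: continuous_subspaceW hc => z; exact: sub.
      apply/subspace_continuousP => y Fiy; apply: cvgB; first exact: hci.
      by apply: cvg_within_filter; exact: tent_continuous.
    by move=> y Fiy; have [k ->] := hth y (sub _ _ Fiy); exists k; rewrite thi //; lra.
  by rewrite /g tent_center; lra.
have hj j x y : j != i -> F j x -> F j y -> h x = h y.
  move=> ji Fjx Fjy; apply: (@connected_integer_constant R V (F j) h) => //.
    by apply: continuous_subspaceW hc => z; exact: sub.
  move=> z Fjz; have [k ->] := hth z (sub _ _ Fjz); have [l ->] := thj j z ji Fjz.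
  by exists (l + k); rewrite intrD.
exists [set j | j != i /\ forall x, F j x -> h x = h v]; split.
- by case; rewrite eqxx.
- by move=> j ji Fjv; split=> // x Fjx; exact: (hj j).
- move=> a b x [ai ha] nYb Fax Fbx; have hx := ha x Fax.
  have [bi|bi] := eqVneq b i.
    by apply: (tent_eq1 d0); have := hi x; rewrite -bi => /(_ Fbx); rewrite hx /g; lra.
  by case: nYb; split=> // y Fby; rewrite -hx; exact: (hj b).
Unshelve. all: by end_near. Qed.

(** The intersection graph of the pieces is connected, since otherwise the pieces
    satisfying [B] and the other ones would split the union; phrased as an
    induction principle along the edges, it needs no paths. *)
Lemma connected_pieces_ind (B : I -> Prop) :
  (forall i, F i !=set0) ->
  (forall a b x, F a x -> F b x -> B a -> B b) ->
  forall a b, B a -> B b.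
Proof.
move=> F0 Bmeet a b Ba; have [x Fax] := F0 a; have [y Fby] := F0 b.
have [c Bc Fcy] : (\bigcup_(i in B) F i) y.
  apply: (connected_sub_closed (contractible_connected F_contractible)
            (Y := \bigcup_(i in ~` B) F i) (p := x)).
  - exact: finite_bigcup_closed.
  - exact: finite_bigcup_closed.
  - by move=> z [i _ Fiz]; have [Bi|nBi] := pselect (B i); [left|right]; exists i.
  - by move=> z _ [i Bi Fiz] [j nBj Fjz]; apply: nBj; exact: (Bmeet i j z).
  - by exists a.
  - by exists a.
  - by exists b.
exact: (Bmeet c b y).
Qed.

(** The hypothesis that no point disconnects [J] is what distinguishes a circle
    from an arc. For every [v], the set [J] minus [v] contains [p], which is on
    the side of [F i] of the cut at [v], hence avoids the branches at [v]. The
    pieces that are not attached to [F i] directly form a closed set disjoint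
    from [F i], which [J] cannot reach either. *)
Lemma circle_in_one_piece (J : set V) i p :
  J `<=` \bigcup_i F i -> (forall v, connected (J `\ v)) -> connected J ->
  J p -> F i p -> (forall j, F j p -> j = i) -> J `<=` F i.
Proof.
move=> JF Jv cJ Jp Fip pi.
apply: (connected_sub_closed cJ
  (Y := \bigcup_(j in [set j | F i `&` F j = set0]) F j) (p := p)) => //.
- exact: finite_bigcup_closed.
- move=> q Jq; have [j _ Fjq] := JF q Jq.
  have [ji|ji] := eqVneq j i; first by left; rewrite -ji.
  have [|/eqP/set0P[v [Fiv Fjv]]] := pselect (F i `&` F j = set0).
    by move=> ij; right; exists j.
  have [->|qv] := pselect (q = v); first by left.
  have [Y [nYi Yv Yx]] := tree_cut Fiv.
  have pv : p <> v by move=> pv; move/eqP : ji; apply; apply: pi; rewrite pv.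
  have [b /= nYb Fbq] : (\bigcup_(a in ~` Y) F a) q.
    apply: (connected_sub_closed (Jv v)
      (Y := \bigcup_(a in Y) F a) (p := p)) => //.
    + exact: finite_bigcup_closed.
    + exact: finite_bigcup_closed.
    + move=> z [Jz _]; have [a _ Faz] := JF z Jz.
      by have [Ya|nYa] := pselect (Y a); [right|left]; exists a.
    + by move=> z [_ zv] [b nYb Fbz] [a Ya Faz]; apply: zv; exact: Yx Ya nYb Faz Fbz.
    + by exists i.
  by case: qv; apply: (Yx j b) => //; exact: Yv.
- move=> z _ Fiz [j /= ij Fjz]; suff : (F i `&` F j) z by rewrite ij.
  by split.
Qed.

End TreeOfPieces.

(** * The Euclidean metric and its similarities *)

Lemma geometric_small (R : realType) (r D e : R) : 0 < r -> r < 1 -> 0 < e ->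
  exists N, r ^+ N * D < e.
Proof.
move=> r0 r1 e0; have D1 : 0 < `|D| + 1 by rewrite ltr_wpDl.
have /cvg_expr/cvgrPdist_lt/(_ (e / (`|D| + 1))) : `|r| < 1 by rewrite gtr0_norm.
rewrite divr_gt0 // => /(_ isT)/filter_ex[N]; rewrite sub0r normrN.
rewrite ger0_norm ?exprn_ge0 ?ltW // ltr_pdivlMr // => rN; exists N.
rewrite (le_lt_trans _ rN) // ler_wpM2l ?exprn_ge0 ?ltW //.
by rewrite (le_lt_trans (ler_norm _)) // ltrDl.
Qed.

Section EuclideanPlane.
Variable R : realType.
Implicit Types (x y z : 'rV[R]_2) (t : R).

Lemma eucl_dist_ge0 x y : 0 <= eucl_dist x y.
Proof. exact: sqrtr_ge0. Qed.

Lemma sqr_eucl_dist x y :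
  eucl_dist x y ^+ 2 = \sum_(i < 2) (x 0 i - y 0 i) ^+ 2.
Proof. by rewrite sqr_sqrtr // sumr_ge0 // => i _; exact: sqr_ge0. Qed.

(** The two comparisons with the sup norm make the Euclidean distance usable for
    the topology of the plane. *)
Lemma norm_le_eucl_dist x y : `|x - y| <= eucl_dist x y.
Proof.
rewrite [leLHS]mx_normrE; apply: bigmax_le; first exact: eucl_dist_ge0.
move=> [i j] _ /=; rewrite ord1 !mxE -sqrtr_sqr; apply: ler_wsqrtr.
rewrite [leRHS](bigD1 j) //= lerDl.
by apply: sumr_ge0 => k _; exact: sqr_ge0.
Qed.

Lemma eucl_dist_le_norm x y : eucl_dist x y <= 2 * `|x - y|.
Proof.
have coord i : `|x 0 i - y 0 i| <= `|x - y|.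
  rewrite [leRHS]mx_normrE.
  have := @le_bigmax _ _ _ 0 (fun ij => `|(x - y) ij.1 ij.2|) (0, i).
  by rewrite /= !mxE.
rewrite -[leRHS]ger0_norm ?mulr_ge0 // -sqrtr_sqr; apply: ler_wsqrtr.
rewrite (@le_trans _ _ (\sum_(i < 2) `|x - y| ^+ 2)) //.
  apply: ler_sum => i _; rewrite -[leLHS]ger0_norm ?sqr_ge0 // normrX.
  by rewrite ler_sqr ?nnegrE.
rewrite sumr_const card_ord exprMn -[leLHS]mulr_natl.
by have := sqr_ge0 `|x - y|; lra.
Qed.

Lemma eucl_dist_eq0 x y : eucl_dist x y = 0 -> x = y.
Proof.
move=> xy0; apply/eqP; rewrite -subr_eq0 -normr_eq0 eq_le normr_ge0 andbT.
by rewrite -xy0 norm_le_eucl_dist.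
Qed.

Lemma eucl_distxx x : eucl_dist x x = 0.
Proof.
apply/eqP; rewrite eq_le eucl_dist_ge0 andbT.
by rewrite (le_trans (eucl_dist_le_norm _ _)) // subrr normr0 mulr0.
Qed.

(** Stewart's theorem: the distances from a point [z] to [x] and [y] determine the
    distance from [z] to the points of the line through [x] and [y]. *)
Lemma stewart x y z t :
  eucl_dist z (t *: x + (1 - t) *: y) ^+ 2 =
  t * eucl_dist z x ^+ 2 + (1 - t) * eucl_dist z y ^+ 2
  - t * (1 - t) * eucl_dist x y ^+ 2.
Proof.
rewrite !sqr_eucl_dist !mulr_sumr -big_split -sumrB /=.
by apply: eq_bigr => i _; rewrite !mxE; ring.
Qed.

(** Both sides of Stewart's identity scale by [r ^+ 2], so the image of an affine
    combination is at distance 0 from the combination of the images. *)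
Lemma similarity_affine (f : 'rV[R]_2 -> 'rV[R]_2) (r : R) :
  (forall x y, eucl_dist (f x) (f y) = r * eucl_dist x y) ->
  forall x y t, f (t *: x + (1 - t) *: y) = t *: f x + (1 - t) *: f y.
Proof.
move=> fr x y t; apply: eucl_dist_eq0; apply/eqP.
rewrite -sqrf_eq0 stewart !fr !exprMn.
have := stewart x y (t *: x + (1 - t) *: y) t; rewrite eucl_distxx => st.
apply/eqP; rewrite expr0n /= in st.
by rewrite -[RHS](mulr0 (r ^+ 2)) [X in _ = _ * X]st; ring.
Qed.

Lemma lipschitz_within_continuous (T : topologicalType) (V W : normedModType R)
    (A : set T) (g : T -> V) (h : T -> W) (k : R) :
  {within A, continuous g} ->
  (forall x y : T, A x -> A y -> `|h x - h y| <= k * `|g x - g y|) ->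
  {within A, continuous h}.
Proof.
move=> /subspace_continuousP gc hg; apply/subspace_continuousP => x Ax.
apply/cvgrPdist_lt => e e0; rewrite near_withinE.
have k0 : 0 < `|k| + 1 by rewrite ltr_wpDl.
have /cvgrPdist_lt/(_ (e / (`|k| + 1))) := gc x Ax.
rewrite near_withinE divr_gt0 // => /(_ isT).
apply: filterS => y + Ay => /(_ Ay) gxy.
rewrite (le_lt_trans (hg _ _ Ax Ay)) //.
rewrite (@le_lt_trans _ _ ((`|k| + 1) * `|g x - g y|)) //.
  by rewrite ler_wpM2r // (le_trans (ler_norm _)) // lerDl.
by rewrite mulrC -ltr_pdivlMr.
Qed.

Lemma similarity_continuous (f : 'rV[R]_2 -> 'rV[R]_2) (r : R) :
  0 <= r -> (forall x y, eucl_dist (f x) (f y) = r * eucl_dist x y) ->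
  continuous f.
Proof.
move=> r0 fr; apply/continuous_subspace_setT.
apply: (@lipschitz_within_continuous _ _ _ _ id f (r * 2)).
  by apply: continuous_subspaceT => ?; exact: cvg_id.
move=> x y _ _; rewrite (le_trans (norm_le_eucl_dist _ _)) // fr -mulrA.
by rewrite ler_wpM2l // eucl_dist_le_norm.
Qed.

Lemma compact_eucl_dist_bounded (K : set 'rV[R]_2) : compact K ->
  exists2 D, 0 < D & forall x y, K x -> K y -> eucl_dist x y < D.
Proof.
move=> /compact_bounded[M [_ MK]].
have {}MK x : K x -> `|x| <= `|M| + 1.
  by move=> Kx; apply: (MK (`|M| + 1)) => //; rewrite (le_lt_trans (ler_norm _)) // ltrDl.
exists (4 * (`|M| + 1) + 1) => [|x y Kx Ky].
  by rewrite ltr_wpDl // mulr_ge0 // addr_ge0.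
rewrite (le_lt_trans (eucl_dist_le_norm _ _)) //.
have := ler_normB x y; have := MK x Kx; have := MK y Ky; lra.
Qed.

Lemma closed_approx (C : set 'rV[R]_2) x : closed C ->
  (forall e : R, 0 < e -> exists2 y, C y & eucl_dist x y < e) -> C x.
Proof.
move=> clC Cx; rewrite (closure_id C).1 // => B /nbhs_normP[e /= e0 xB].
have [y Cy xy] := Cx e e0; exists y; split=> //; apply: xB.
exact: le_lt_trans (norm_le_eucl_dist _ _) xy.
Qed.

End EuclideanPlane.

(** * Convex hulls *)

Section Convexity.
Variable R : realType.
Implicit Types (x y a : 'rV[R]_2) (X C P : set 'rV[R]_2) (t : R).

Lemma convex_setP C : @convex_set R 'rV[R]_2 C <->
  forall x y t, C x -> C y -> 0 <= t <= 1 -> C (t *: x + (1 - t) *: y).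
Proof.
split=> [cC x y t Cx Cy /andP[t0 t1]|cC x y l /set_mem Cx /set_mem Cy].
  by have /set_mem := cC x y (Itv01 t0 t1) (mem_set Cx) (mem_set Cy).
by apply/mem_set/cC => //; rewrite ge0 le1.
Qed.

Lemma convex_hull_convex X : @convex_set R 'rV[R]_2 (convex_hull X).
Proof.
apply/convex_setP => x y t Xx Xy t01 C [cC XC].
by move/convex_setP : (cC); apply => //; [exact: Xx|exact: Xy].
Qed.

Lemma sub_convex_hull X : X `<=` convex_hull X.
Proof. exact: sub_gen_smallest. Qed.

Lemma convex_hull_min X C : @convex_set R 'rV[R]_2 C -> X `<=` C ->
  convex_hull X `<=` C.
Proof. exact: smallest_sub. Qed.

(** The cone over [C] without its apex [a]. It stays convex without the apex,
    which is how extreme points are detected. *)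
Definition punctured_cone a C : set 'rV[R]_2 :=
  [set z | exists t q, [/\ 0 < t <= 1, C q & z = (1 - t) *: a + t *: q]].

Lemma punctured_cone_convex a C : @convex_set R 'rV[R]_2 C ->
  @convex_set R 'rV[R]_2 (punctured_cone a C).
Proof.
move=> /convex_setP cC; apply/convex_setP => x y t.
move=> [u [p [/andP[u0 u1] Cp ->]]] [v [q [/andP[v0 v1] Cq ->]]] /andP[t0 t1].
pose w := t * u + (1 - t) * v.
have w0 : 0 < w.
  have [t00|tN0] := eqVneq t 0; first by rewrite /w t00; lra.
  have tp : 0 < t by rewrite lt_neqAle eq_sym tN0.
  by rewrite /w; nra.
have w1 : w <= 1 by rewrite /w; nra.
exists w, ((t * u / w) *: p + (1 - t * u / w) *: q).
split; first by rewrite w0.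
  apply: cC => //; rewrite divr_ge0 ?mulr_ge0 ?(ltW u0) ?(ltW w0) //=.
  by rewrite ler_pdivrMr // mul1r /w lerDl; nra.
have -> : t * u / w = 1 - (1 - t) * v / w.
  by apply: (mulIf (lt0r_neq0 w0)); rewrite mulrBl !divfK ?lt0r_neq0 // /w; lra.
apply/rowP => i; rewrite !mxE.
have e1 : w * ((1 - t) * v / w) = (1 - t) * v by rewrite mulrC divfK ?lt0r_neq0.
transitivity ((1 - w) * a 0 i + (w - w * ((1 - t) * v / w)) * p 0 i
     + w * ((1 - t) * v / w) * q 0 i); last by ring.
by rewrite e1 /w; ring.
Qed.

Lemma cone_convex a C : @convex_set R 'rV[R]_2 C ->
  @convex_set R 'rV[R]_2 (a |` punctured_cone a C).
Proof.
move=> cC; have /convex_setP cE := @punctured_cone_convex a C cC.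
have apex t p : 0 <= t <= 1 -> punctured_cone a C p ->
    (a |` punctured_cone a C) ((1 - t) *: a + t *: p).
  move=> /andP[t0 t1] [u [q [/andP[u0 u1] Cq ->]]].
  have [->|tN0] := eqVneq t 0; first by left; rewrite subr0 scale1r scale0r addr0.
  right; exists (t * u), q; split=> //.
    by have : 0 < t by [rewrite lt_neqAle eq_sym tN0]; move=> ?; apply/andP; split; nra.
  by apply/rowP => i; rewrite !mxE; ring.
apply/convex_setP => x y t [->|Ex] [->|Ey] t01.
- by left; rewrite -scalerDl addrC subrK scale1r.
- rewrite -{1}(subKr 1 t); apply: apex => //; lra.
- by rewrite addrC; apply: apex.
- by right; exact: cE.
Qed.

(** Adding a point [a] to a finite set replaces its hull by the cone over it with
    apex [a], a continuous image of the product of the hull with [0, 1]. *)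
Lemma compact_convex_hull_seq (s : seq 'rV[R]_2) :
  compact (convex_hull [set` s]).
Proof.
elim: s => [|a s IHs].
  rewrite (_ : convex_hull _ = set0); first exact: compact0.
  rewrite -subset0; apply: convex_hull_min; first by apply/convex_setP.
  by move=> y /=; rewrite in_nil.
pose C : set 'rV[R]_2 := convex_hull [set` s].
have -> : convex_hull [set` a :: s] = [set a] `|`
    (fun z : R * 'rV[R]_2 => (1 - z.1) *: a + z.1 *: z.2) @` (`[0, 1] `*` C).
  apply/seteqP; split=> z.
  + have sub : convex_hull [set` a :: s] `<=` a |` punctured_cone a C.
      apply: convex_hull_min; first exact/cone_convex/convex_hull_convex.
      move=> y /=; rewrite inE => /predU1P[->|ys]; first by left.
      right; exists 1, y; split; [lra|exact: sub_convex_hull|].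
      by rewrite subrr scale0r add0r scale1r.
    move=> /sub[->|[t [q [/andP[t0 t1] Cq ->]]]]; first by left.
    right; exists (t, q) => //; split=> //=.
    by rewrite in_itv /= t1 ltW.
  + have /convex_setP cH := @convex_hull_convex [set` a :: s].
    have Ha : convex_hull [set` a :: s] a by apply: sub_convex_hull; exact: mem_head.
    move=> [->//|[[t q] [/= t01 Cq] <-]].
    rewrite in_itv /= in t01; rewrite addrC; apply: cH => //.
    apply: convex_hull_min Cq; first exact: convex_hull_convex.
    by move=> y ys; apply: sub_convex_hull; rewrite /= inE; apply/orP; right.
apply: compactU; first exact: compact_set1.
apply: continuous_compact; last first.
  by apply: compact_setX => //; exact: segment_compact.
apply: continuous_subspaceT => -[t q].
apply: cvgD.
  apply: cvgZ; [|exact: cvg_cst].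
  by apply: cvgB; [exact: cvg_cst|exact: cvg_fst].
by apply: cvgZ; [exact: cvg_fst|exact: cvg_snd].
Qed.

Lemma convex_connected C : @convex_set R 'rV[R]_2 C -> connected C.
Proof.
move=> /convex_setP cC; have [->|/set0P[a Ca]] := eqVneq C set0; first exact: connected0.
pose seg x := (fun t => t *: a + (1 - t) *: x) @` `[0, 1].
have -> : C = \bigcup_(x in C) seg x.
  apply/seteqP; split=> [x Cx|y [x Cx] [t] /=].
    exists x => //; exists 0; first by rewrite /= in_itv /= lexx ler01.
    by rewrite scale0r add0r subr0 scale1r.
  by rewrite in_itv /= => t01 <-; exact: cC.
apply: bigcup_connected.
  exists a => x Cx; exists 1; first by rewrite /= in_itv /= lexx ler01.
  by rewrite subrr scale0r addr0 scale1r.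
move=> x Cx; apply: connected_continuous_connected; first exact: segment_connected.
apply: continuous_subspaceT => t.
apply: cvgD; apply: cvgZ; [exact: cvg_id|exact: cvg_cst| |exact: cvg_cst].
by apply: cvgB; [exact: cvg_cst|exact: cvg_id].
Qed.

(** A vertex [A k] is extreme: without its apex, the cone from [A k] over the hull
    of the other vertices is still convex. If [f] missed [A k] on the
    vertices, the preimage of that cone would be a convex set containing all
    vertices, hence [P], and [A k] would not be in the image of [P]. *)
Lemma vertex_of_affine_copy n P (A : 'I_n -> 'rV[R]_2)
    (f : 'rV[R]_2 -> 'rV[R]_2) k :
  convex_polygon P A ->
  (forall x y t, f (t *: x + (1 - t) *: y) = t *: f x + (1 - t) *: f y) ->
  (forall j, P (f (A j))) -> (f @` P) (A k) -> exists j, f (A j) = A k.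
Proof.
move=> [PE _ /(_ k) Ak] faff PfA [p Pp fp]; apply: contrapT => nofj.
set H := convex_hull _ in Ak.
have cH : @convex_set R 'rV[R]_2 H by exact: convex_hull_convex.
have PE' : P `<=` A k |` punctured_cone (A k) H.
  rewrite PE; apply: convex_hull_min; first exact: cone_convex.
  move=> _ [j _ <-]; have [->|jk] := eqVneq j k; first by left.
  right; exists 1, (A j); split; [lra| |by rewrite subrr scale0r add0r scale1r].
  by apply: sub_convex_hull; exists j.
have /convex_setP cE := @punctured_cone_convex (A k) H cH.
have : (f @^-1` punctured_cone (A k) H) p.
  have : convex_hull (range A) p by rewrite -PE.
  apply: convex_hull_min.
    by apply/convex_setP => x y t Ex Ey t01; rewrite /preimage /= faff; exact: cE.
  move=> _ [j _ <-]; have [//|//] := PE' _ (PfA j).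
  by move=> fAj; case: nofj; exists j.
rewrite /preimage /= fp => -[t [q [/andP[t0 _] Hq Aq]]]; apply: Ak.
suff -> : A k = q by [].
apply: (scalerI (lt0r_neq0 t0)); apply: (addrI ((1 - t) *: A k)).
by rewrite -Aq -scalerDl subrK scale1r.
Qed.

End Convexity.

(** * Polygonal tree systems and their attractors *)

Section PolygonalTreeSystem.
Variables (R : realType) (n m : nat) (P : set 'rV[R]_2) (A : 'I_n -> 'rV[R]_2).
Variables (S : 'I_m -> 'rV[R]_2 -> 'rV[R]_2) (K : set 'rV[R]_2).
Hypothesis P_polygon : convex_polygon P A.
Hypothesis S_sim : forall i, contracting_similarity (S i).
Hypothesis PS_tree : polygonal_tree_system P A S.
Hypothesis K_attr : attractor S K.

Let piece i := S i @` P.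

Lemma similarity_ratio i : exists r : R, 0 < r /\
  forall x y, eucl_dist (S i x) (S i y) = r * eucl_dist x y.
Proof. by have [r [/andP[r0 _] Sr]] := S_sim i; exists r. Qed.

Lemma uniform_ratio : exists r : R, [/\ 0 < r, r < 1 &
  forall i x y, eucl_dist (S i x) (S i y) <= r * eucl_dist x y].
Proof.
have /filter_forall nr i : \forall r \near (1:R)^'-,
    forall x y, eucl_dist (S i x) (S i y) <= r * eucl_dist x y.
  have [s [/andP[s0 s1] Ss]] := S_sim i.
  apply: filterS (nbhs_left_gt s1) => r /ltW sr x y.
  by rewrite Ss ler_wpM2r // eucl_dist_ge0.
have := filter_ex (filterI (nbhs_left_gt (ltr01 : (0:R) < 1))
  (filterI (nbhs_left_lt (1:R)) nr)).
by move=> [r [r0 [r1 Sr]]]; exists r.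
Qed.

Lemma similarity_inj i : injective (S i).
Proof.
move=> x y Sxy; have [r [r0 Sr]] := similarity_ratio i.
apply: eucl_dist_eq0; apply/eqP; have := Sr x y.
by rewrite Sxy eucl_distxx => /esym/eqP; rewrite mulf_eq0 gt_eqF.
Qed.

Lemma S_continuous i : continuous (S i).
Proof.
by have [r [r0 Sr]] := similarity_ratio i; apply: similarity_continuous (ltW r0) Sr.
Qed.

Lemma S_within_continuous i (C : set 'rV[R]_2) : {within C, continuous (S i)}.
Proof. by apply: continuous_subspaceT; exact: S_continuous. Qed.

Lemma polygon_compact : compact P.
Proof.
have [-> _ _] := P_polygon.
rewrite (_ : range A = [set` [seq A i | i <- enum 'I_n]]).
  exact: compact_convex_hull_seq.
apply/seteqP; split=> [_ [i _ <-]|x /= /mapP[i _ ->]]; last by exists i.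
by rewrite /=; apply/mapP; exists i => //; rewrite mem_enum.
Qed.

Lemma polygon_vertex k : P (A k).
Proof. by have [-> _ _] := P_polygon; apply: sub_convex_hull; exists k. Qed.

Lemma polygon_neq0 : P !=set0.
Proof. by have [_ [x /interior_subset Px] _] := P_polygon; exists x. Qed.

Lemma piece_compact i : compact (piece i).
Proof.
by apply: continuous_compact; [exact: S_within_continuous|exact: polygon_compact].
Qed.

Lemma piece_connected i : connected (piece i).
Proof.
apply: connected_continuous_connected; last exact: S_within_continuous.
by apply: convex_connected; have [-> _ _] := P_polygon; exact: convex_hull_convex.
Qed.

Lemma pieces_meet i j x y : i != j ->
  piece i x -> piece j x -> piece i y -> piece j y -> x = y.
Proof.
move=> ij ix jx iy jy; have [_ /(_ i j ij) PD _ _] := PS_tree.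
have xI : (S i @` P `&` S j @` P) x by [].
have yI : (S i @` P `&` S j @` P) y by [].
case: PD => [E|[z [E _ _]]]; first by move: xI; rewrite E.
by move: xI yI; rewrite E => -> ->.
Qed.

Lemma common_vertex i j x : i != j -> piece i x -> piece j x ->
  range (S i \o A) x /\ range (S j \o A) x.
Proof.
move=> ij ix jx; have [_ /(_ i j ij) PD _ _] := PS_tree.
have xI : (S i @` P `&` S j @` P) x by [].
case: PD => [E|[z [E iz jz]]]; first by move: xI; rewrite E.
by move: xI; rewrite E => ->.
Qed.

Lemma attractor_piece i x : K x -> K (S i x).
Proof. by move=> Kx; have [_ _ ->] := K_attr; exists i => //; exists x. Qed.

Lemma attractor_split x : K x -> exists i, exists2 y, K y & S i y = x.
Proof. by have [_ _ {1}->] := K_attr => -[i _ [y Ky <-]]; exists i, y. Qed.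

(** Every point of [X] has an address in the system; applying the maps of its
    first [N] digits to a base point of [Y] gives a point of [Y] within
    [r ^+ N * D] of it. *)
Lemma follow_address (X Y : set 'rV[R]_2) :
  compact X -> compact Y -> Y !=set0 ->
  (forall x, X x -> exists i, exists2 x', X x' & S i x' = x) ->
  (forall i y, Y y -> Y (S i y)) -> X `<=` Y.
Proof.
move=> cX cY [y0 Yy0] Xsplit Ystep x Xx.
have [r [r0 r1 Sr]] := uniform_ratio.
have [D D0 XD] := compact_eucl_dist_bounded (compactU cX cY).
have near_Y N : forall x, X x -> exists2 y, Y y & eucl_dist x y <= r ^+ N * D.
  elim: N => [|N IHN] {Xx}x Xx.
    by exists y0 => //; rewrite expr0 mul1r ltW // XD; [|left|right].
  have [i [x' Xx' <-]] := Xsplit x Xx; have [y Yy x'y] := IHN x' Xx'.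
  exists (S i y); first exact: Ystep.
  by rewrite (le_trans (Sr _ _ _)) // exprS -mulrA ler_wpM2l // ltW.
apply: closed_approx; first by apply: compact_closed => //; exact: norm_hausdorff.
move=> e e0; have [N rN] := geometric_small D r0 r1 e0.
by have [y Yy xy] := near_Y N x Xx; exists y => //; exact: le_lt_trans rN.
Qed.

Lemma attractor_sub_polygon : K `<=` P.
Proof.
have [K0 cK _] := K_attr; have [PS _ _ _] := PS_tree.
apply: follow_address => //.
- exact: polygon_compact.
- exact: polygon_neq0.
- exact: attractor_split.
- by move=> i y Py; apply: (PS i); exists y.
Qed.

Lemma vertex_in_attractor k : K (A k).
Proof.
have [K0 cK _] := K_attr; have [PS _ PV _] := PS_tree.
suff sub : range A `<=` K by apply: sub; exists k.
(* each vertex of P has an address consisting of vertices *)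
apply: follow_address => //.
- rewrite (_ : range A = \bigcup_i [set A i]).
    by apply: finite_bigcup_compact => i; exact: compact_set1.
  by apply/seteqP; split=> [_ [i _ <-]|_ [i _ ->]]; exists i.
- move=> _ [l _ <-]; have [i iAl] := PV l.
  have [r [r0 Sr]] := similarity_ratio i.
  have [j SAj] : exists j, S i (A j) = A l.
    apply: (vertex_of_affine_copy P_polygon) iAl => //.
      exact: similarity_affine Sr.
    by move=> j; apply: (PS i); exists (A j) => //; exact: polygon_vertex.
  by exists i, (A j).
- by move=> i y; exact: attractor_piece.
Qed.

Lemma common_point_in_attractor i j x : i != j -> piece i x -> piece j x ->
  (S i @` K) x /\ (S j @` K) x.
Proof.
move=> ij ix jx; have [[k _ <-] [l _ jl]] := common_vertex ij ix jx.
split; first by exists (A k) => //; exact: vertex_in_attractor.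
by rewrite -jl; exists (A l) => //; exact: vertex_in_attractor.
Qed.

(** A point of [K] that lies in [P_i] but comes from another copy is a common
    vertex, and vertices belong to [K]. *)
Lemma attractor_in_piece i x : K x -> piece i x -> (S i @` K) x.
Proof.
move=> Kx ix; have [j [y Ky Sy]] := attractor_split Kx.
have [ij|ij] := eqVneq i j; first by rewrite ij; exists y.
have jx : piece j x by exists y => //; exact: attractor_sub_polygon.
by have [] := common_point_in_attractor ij ix jx.
Qed.

(** Induction on the scale: pulling [Q] back along [S i] multiplies its scale by
    [1 / r], so [Q] is constant on each copy [S i @` K]; copies whose pieces
    meet share a point, so [Q] has the same value on all of them. *)
Lemma uniformly_constant (N : nat) (r D : R) :
  0 < r -> (forall i x y, eucl_dist (S i x) (S i y) <= r * eucl_dist x y) ->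
  (forall x y, K x -> K y -> eucl_dist x y < D) ->
  forall Q : 'rV[R]_2 -> Prop,
  (forall x y, K x -> K y -> eucl_dist x y < r ^+ N * D -> Q x -> Q y) ->
  forall x y, K x -> K y -> Q x -> Q y.
Proof.
move=> r0 Sr KD; elim: N => [|N IHN] Q Qunif x y Kx Ky Qx.
  by apply: (Qunif x) => //; rewrite expr0 mul1r; exact: KD.
have cell i u v : K u -> K v -> Q (S i u) -> Q (S i v).
  apply: (IHN (Q \o S i)) => {}u {}v Ku Kv uv /=.
  apply: Qunif; [exact: attractor_piece..|].
  by rewrite (le_lt_trans (Sr _ _ _)) // exprS -mulrA ltr_pM2l.
have [i [u Ku Su]] := attractor_split Kx; have [j [v Kv Sv]] := attractor_split Ky.
rewrite -Sv; have [_ _ _ ctr] := PS_tree.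
apply: (@connected_pieces_ind R _ _ piece piece_compact ctr
  (fun a => forall w, K w -> Q (S a w)) _ _ i j) => // [a|a b z az bz Qa|w Kw].
- by have [p Pp] := polygon_neq0; exists (S a p); exists p.
- have [<-//|ab] := eqVneq a b => w Kw.
  have [[z1 Kz1 E1] [z2 Kz2 E2]] := common_point_in_attractor ab az bz.
  by apply: (cell b z2) => //; rewrite E2 -E1; exact: Qa.
- by apply: (cell i u) => //; rewrite Su.
Qed.

Lemma attractor_connected : connected K.
Proof.
have [K0 cK _] := K_attr; have [r [r0 r1 Sr]] := uniform_ratio.
have [D D0 KD] := compact_eucl_dist_bounded cK.
apply/connected_locally_constantP => Q Qloc.
have [d d0 Qd] := lebesgue_number cK Qloc.
have [N rN] := geometric_small D r0 r1 d0.
apply: (uniformly_constant (N := N) r0 Sr KD) => x y Kx Ky xy.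
apply: Qd => //; rewrite (le_lt_trans (norm_le_eucl_dist _ _)) //.
exact: lt_trans rN.
Qed.

Lemma attractor_cells (r D : R) N : 0 < r ->
  (forall i x y, eucl_dist (S i x) (S i y) <= r * eucl_dist x y) ->
  (forall x y, K x -> K y -> eucl_dist x y < D) ->
  exists (I : finType) (C : I -> set 'rV[R]_2),
    [/\ K = \bigcup_i C i,
        forall i, compact (C i), forall i, connected (C i) &
        forall i x y, C i x -> C i y -> eucl_dist x y < r ^+ N * D].
Proof.
move=> r0 Sr KD; have [_ cK KE] := K_attr.
elim: N => [|N [I [C [KC cC connC CD]]]].
  exists unit, (fun=> K); split=> //.
  - by apply/seteqP; split=> [x Kx|x [] //]; exists tt.
  - by move=> _; exact: attractor_connected.
  - by move=> _ x y Kx Ky; rewrite expr0 mul1r; exact: KD.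
exists ('I_m * I)%type, (fun p => S p.1 @` C p.2); split.
- apply/seteqP; split=> [x|x [[i a] _ [y /= Cy <-]]].
    move=> /attractor_split[i [y + <-]]; rewrite {1}KC => -[a _ Cy].
    by exists (i, a) => //; exists y.
  by apply: attractor_piece; rewrite KC; exists a.
- move=> [i a] /=; apply: continuous_compact => //; exact: S_within_continuous.
- move=> [i a] /=; apply: connected_continuous_connected => //.
  exact: S_within_continuous.
- move=> [i a] _ _ /= [x Cx <-] [y Cy <-]; rewrite (le_lt_trans (Sr _ _ _)) //.
  by rewrite exprS -mulrA ltr_pM2l //; exact: CD Cx Cy.
Qed.

Lemma attractor_locally_connected : locally_connected K.
Proof.
have [K0 cK _] := K_attr; have [r [r0 r1 Sr]] := uniform_ratio.
have [D D0 KD] := compact_eucl_dist_bounded cK.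
apply: small_connected_covers_locally_connected => e e0.
have [N rN] := geometric_small D r0 r1 e0.
have [I [C [KC cC connC CD]]] := attractor_cells N r0 Sr KD.
exists I, C; split=> //.
  by move=> i; apply: compact_closed => //; exact: norm_hausdorff.
move=> i x y Cx Cy; rewrite (le_lt_trans (norm_le_eucl_dist _ _)) //.
exact: lt_trans (CD i x y Cx Cy) rN.
Qed.

Definition closed_curve_in_attractor (g : R -> 'rV[R]_2) :=
  [/\ {within `[0, 1], continuous g}, g 0 = g 1,
      {in `[0, 1[ &, injective g} & forall t, t \in `[0, 1] -> K (g t)].

(** A point of the curve that is not a vertex of any piece belongs to a single
    piece, and the curve cannot leave that piece. *)
Lemma closed_curve_descends g : closed_curve_in_attractor g ->
  exists i g', closed_curve_in_attractor g' /\
    forall t, t \in `[0, 1] -> S i (g' t) = g t.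
Proof.
move=> [gc g01 ginj gK]; have [_ _ _ ctr] := PS_tree.
have [t t01 gt] :=
  injective_curve_avoids_finite (fun ik : 'I_m * 'I_n => S ik.1 (A ik.2)) ginj.
have t01' : t \in `[0, 1].
  by move: t01; rewrite !in_itv /= => /andP[-> /ltW].
have [i [y Ky Sy]] := attractor_split (gK t t01').
have ipt : piece i (g t) by exists y => //; exact: attractor_sub_polygon.
have sub : g @` `[0, 1] `<=` piece i.
  apply: (@circle_in_one_piece R _ _ piece piece_compact piece_connected pieces_meet
    ctr _ i (g t)) => //.
  - move=> _ [s s01 <-]; have [j [z Kz <-]] := attractor_split (gK s s01).
    by exists j => //; exists z => //; exact: attractor_sub_polygon.
  - by move=> v; exact: punctured_closed_curve_connected.
  - by apply: connected_continuous_connected => //; exact: segment_connected.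
  - move=> j jpt; apply/eqP; apply: contrapT => /negP ji.
    by have [[k _ Ak] _] := common_vertex ji jpt ipt; apply: (gt (j, k)).
have gpre s : s \in `[0, 1] -> exists2 y, K y & S i y = g s.
  by move=> s01; apply: attractor_in_piece; [exact: gK|apply: sub; exists s].
have [g' g'P] : {g' : R -> 'rV[R]_2 &
    forall s, s \in `[0, 1] -> K (g' s) /\ S i (g' s) = g s}.
  apply: (@choice _ _ (fun s y => s \in `[0, 1] -> K y /\ S i y = g s)) => s.
  have [/gpre[z Kz Sz]|//] := boolP (s \in `[0, 1]); first by exists z.
  by exists 0.
exists i, g'; split; last by move=> s /g'P[].
have [r [r0 Sr]] := similarity_ratio i.
have m0 : (0 : R) \in `[0, 1] by rewrite in_itv /= lexx ler01.
have m1 : (1 : R) \in `[0, 1] by rewrite in_itv /= lexx ler01.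
split.
- apply: (lipschitz_within_continuous (k := 2 / r) gc) => s u s01 u01.
  rewrite [2 / r]mulrC -mulrA ler_pdivlMl //.
  have [_ <-] := g'P s s01; have [_ <-] := g'P u u01.
  rewrite (le_trans _ (eucl_dist_le_norm _ _)) // Sr ler_wpM2l ?(ltW r0) //.
  exact: norm_le_eucl_dist.
- by apply: (@similarity_inj i); rewrite (g'P 0 m0).2 (g'P 1 m1).2.
- move=> s u s01 u01 g'su; apply: ginj => //.
  have sub01 w : w \in `[0, 1[ -> w \in (`[0, 1] : interval R).
    by rewrite !in_itv /= => /andP[-> /ltW].
  by rewrite -(g'P s (sub01 s s01)).2 -(g'P u (sub01 u u01)).2 g'su.
- by move=> s /g'P[].
Qed.

Lemma closed_curve_small (r D : R) N g : 0 < r ->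
  (forall i x y, eucl_dist (S i x) (S i y) <= r * eucl_dist x y) ->
  (forall x y, K x -> K y -> eucl_dist x y < D) ->
  closed_curve_in_attractor g -> forall s t, s \in `[0, 1] -> t \in `[0, 1] ->
  eucl_dist (g s) (g t) < r ^+ N * D.
Proof.
move=> r0 Sr KD; elim: N g => [|N IHN] g gcurve s t s01 t01.
  by rewrite expr0 mul1r; case: gcurve => _ _ _ gK; apply: KD; exact: gK.
have [i [g' [g'curve Sg']]] := closed_curve_descends gcurve.
rewrite -!Sg' // (le_lt_trans (Sr _ _ _)) // exprS -mulrA ltr_pM2l //.
exact: IHN.
Qed.

Lemma attractor_no_closed_curve : ~ exists2 C, simple_closed_curve R C & C `<=` K.
Proof.
move=> [_ [g [gc g01 ginj <-]] gK].
have gcurve : closed_curve_in_attractor g.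
  by split=> // t t01; apply: gK; exists t.
have [K0 cK _] := K_attr; have [r [r0 r1 Sr]] := uniform_ratio.
have [D D0 KD] := compact_eucl_dist_bounded cK.
have m0 : (0 : R) \in `[0, 1[ by rewrite in_itv /= lexx ltr01.
have m2 : (2^-1 : R) \in `[0, 1[ by rewrite in_itv /=; lra.
have g0N : 0 < eucl_dist (g 0) (g 2^-1).
  rewrite lt_neqAle eucl_dist_ge0 andbT; apply/eqP => /esym/eucl_dist_eq0.
  by move=> /(ginj _ _ m0 m2); lra.
have [N rN] := geometric_small D r0 r1 g0N.
have sub01 w : w \in `[0, 1[ -> w \in (`[0, 1] : interval R).
  by rewrite !in_itv /= => /andP[-> /ltW].
have := closed_curve_small N r0 Sr KD gcurve (sub01 _ m0) (sub01 _ m2).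
by move=> /(lt_trans rN); rewrite ltxx.
Qed.

End PolygonalTreeSystem.

Theorem theorem12 (R : realType) (n m : nat) (P : set (plane R))
    (A : 'I_n -> plane R) (S : 'I_m -> plane R -> plane R)
    (K : set (plane R)) :
  convex_polygon P A ->
  (forall i, contracting_similarity (S i)) ->
  polygonal_tree_system P A S ->
  attractor S K ->
  dendrite K.
Proof.
move=> PA S_sim PS K_attr; have [K0 cK _] := K_attr.
split.
- split=> //; exact: attractor_connected PA S_sim PS K_attr.
- exact: attractor_locally_connected PA S_sim PS K_attr.
- exact: attractor_no_closed_curve PA S_sim PS K_attr.
Qed.
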